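(* Let $M$ be a finite set endowed with two metrics $d_0$ and $d_1$, and let $r:M\to(0,\infty)$ be a function such that for all $x,y\in M$ $$|d_0(x,y)-d_1(x,y)|\le r(x)+r(y)\quad\text{and}\quad |r(x)-r(y)|\le d_0(x,y)+d_1(x,y).$$ Let $(M\times\mathbb{F}_2,d)$ be the generalized twisted union of $(M,d_0)$ and $(M,d_1)$ with the joining function $r(\cdot)$. Suppose that $r(\cdot)$ is Lipschitz with respect to both metrics $d_0$ and $d_1$, that is, suppose that there exists a constant $L>0$ such that for all $x,y\in M$ $$|r(x)-r(y)|\le L\min\{d_0(x,y),d_1(x,y)\}.$$ Denote $h(x,y)=\min\{d_0(x,y),d_1(x,y)\}$. (a) Then for all $x,y\in M$ $$\frac1A\Big(h(x,y)+\max\{r(x),r(y)\}\Big)\le d((x,0),(y,1))\le h(x,y)+\max\{r(x),r(y)\},$$ where $A=\max\{2L+1,3\}$. (b) If the joining function is constant with $r(x)=r>0$ for all $x\in M$, then for all $x,y\in M$ $$\frac13\Big(r+h(x,y)\Big)\le d((x,0),(y,1))\le r+h(x,y).$$ (c) If $h(x,y)=\min\{d_0(x,y),d_1(x,y)\}$ is a metric on $M$ and the joining function is constant with $r(x)=r>0$ for all $x\in M$, then for all $x,y\in M$ $$d((x,0),(y,1))=r+h(x,y).$$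
   Context: $\mathbb{F}_2=\{0,1\}$. Generalized twisted union: Let $M$ be a finite set endowed with two metrics $d_0,d_1$ and let $r:M\to(0,\infty)$ be a function such that $|d_0(x,y)-d_1(x,y)|\le r(x)+r(y)$ and $|r(x)-r(y)|\le d_0(x,y)+d_1(x,y)$ for all $x,y\in M$. The generalized twisted union of $(M,d_0)$ and $(M,d_1)$ with the joining function $r$ is the set $M\times\mathbb{F}_2$ with the metric $d$ defined as the shortest path metric of the weighted graph on $M\times\mathbb{F}_2$ with the following edges: for all $x,y\in M$, an edge between $(x,0)$ and $(y,0)$ of weight $d_0(x,y)$; for all $x,y\in M$, an edge between $(x,1)$ and $(y,1)$ of weight $d_1(x,y)$; for every $x\in M$, an edge between $(x,0)$ and $(x,1)$ of weight $r(x)$. *)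

(* Defs.v *)
From mathcomp Require Import all_boot all_order all_algebra.
From mathcomp Require Import classical_sets reals.

Set Implicit Arguments.
Unset Strict Implicit.
Unset Printing Implicit Defensive.

Import Order.TTheory GRing.Theory Num.Theory.
Local Open Scope ring_scope.

Record is_metric (R : realType) (T : Type) (d : T -> T -> R) : Prop := IsMetric {
  metric_ge0 : forall x y, 0 <= d x y;
  metric_eq0 : forall x y, d x y = 0 <-> x = y;
  metric_sym : forall x y, d x y = d y x;
  metric_triangle : forall x y z, d x z <= d x y + d y z
}.

Section ShortestPath.
Variables (R : realType) (V : eqType) (e : rel V) (w : V -> V -> R).

Fixpoint path_weight (u : V) (p : seq V) : R :=
  if p is v :: p' then w u v + path_weight v p' else 0.

(* When the graph is finite and connected and [w] is nonnegative, this infimum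
   is a minimum. *)
Definition shortest_path_dist (u v : V) : R :=
  inf [set path_weight u p | p in [set p | path e u p /\ last u p = v]]%classic.

End ShortestPath.

Section TwistedUnion.
Variables (R : realType) (M : finType) (d0 d1 : M -> M -> R) (r : M -> R).

Definition joining_compatible : Prop :=
  forall x y : M, `|d0 x y - d1 x y| <= r x + r y /\
                  `|r x - r y| <= d0 x y + d1 x y.

Definition twisted_edge : rel (M * 'F_2) :=
  fun u v => (u.2 == v.2) || (u.1 == v.1).

(* Only meaningful on pairs related by [twisted_edge]. *)
Definition twisted_weight (u v : M * 'F_2) : R :=
  if u.2 == v.2 then (if u.2 == 0 then d0 u.1 v.1 else d1 u.1 v.1)
  else r u.1.

Definition twisted_union_dist : M * 'F_2 -> M * 'F_2 -> R :=
  shortest_path_dist twisted_edge twisted_weight.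

Definition min_dist (x y : M) : R := Num.min (d0 x y) (d1 x y).

End TwistedUnion.

(* Main.v *)
(* The compatibility condition d1(z,w) <= r(z) + d0(z,w) + r(w) shows that an
   excursion from layer 1 into layer 0 and back never shortens a path.  Hence
     d((x,0),(y,1)) = min over w of d0(x,w) + r(w) + d1(w,y).
   Taking w = x and w = y gives the upper bounds.  For the lower bounds, with
   a = d0(x,w) and b = d1(w,y), the triangle inequality through w and the
   compatibility condition give h(x,y) <= a + b + r(w) + min(r(x), r(y)), and
   r(x) <= r(w) + L a, r(y) <= r(w) + L b; if h is a metric then directly
   h(x,y) <= a + b. *)
Require Import Defs.
From mathcomp Require Import all_boot all_order all_algebra.
From mathcomp Require Import classical_sets reals.
From mathcomp Require Import lra.

Set Implicit Arguments.
Unset Strict Implicit.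
Unset Printing Implicit Defensive.

Import Order.TTheory GRing.Theory Num.Theory.
Local Open Scope ring_scope.

Section ShortestPathBounds.
Variables (R : realType) (V : eqType) (e : rel V) (w : V -> V -> R).

Lemma path_weight_ge0 (u : V) (p : seq V) :
  (forall u v, 0 <= w u v) -> 0 <= path_weight w u p.
Proof. by move=> w0; elim: p u => //= v p IH u; rewrite addr_ge0. Qed.

Lemma shortest_path_dist_le (u v : V) (p : seq V) :
  (forall u v, 0 <= w u v) -> path e u p -> last u p = v ->
  shortest_path_dist e w u v <= path_weight w u p.
Proof.
move=> w0 pp lp; apply: ge_inf; last by exists p.
by exists 0 => _ [q _ <-]; exact: path_weight_ge0.
Qed.

(** The infimum of the empty set is 0 by convention, so a lower bound on all path weights passes to
    the distance only once some path is known to exist. *)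
Lemma le_shortest_path_dist (u v : V) (c : R) :
  (exists2 p, path e u p & last u p = v) ->
  (forall p, path e u p -> last u p = v -> c <= path_weight w u p) ->
  c <= shortest_path_dist e w u v.
Proof.
move=> [p pp lp] cP; apply: lb_le_inf; first by exists (path_weight w u p), p.
by move=> _ [q [qp lq] <-]; exact: cP.
Qed.

End ShortestPathBounds.

Lemma F2_neq0 (i : 'F_2) : i != 0 -> i = 1.
Proof. by case: i => [[|[|//]] lti] // _; exact: val_inj. Qed.

Section TwistedUnionDistance.
Variables (R : realType) (M : finType) (d0 d1 : M -> M -> R) (r : M -> R).
Hypotheses (hd0 : is_metric d0) (hd1 : is_metric d1) (hr : forall x, 0 < r x).
Hypothesis hcompat : joining_compatible d0 d1 r.

Let edge := @twisted_edge M.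
Let weight := twisted_weight d0 d1 r.
Let d := twisted_union_dist d0 d1 r.

Lemma twisted_weight_ge0 (u v : M * 'F_2) : 0 <= weight u v.
Proof.
rewrite /weight /twisted_weight; case: ifP => _; last exact: ltW.
by case: ifP => _; [exact: metric_ge0 hd0 _ _ | exact: metric_ge0 hd1 _ _].
Qed.

(** Induction on the path strips its first edge, which may change layer, so both starting layers
    have to be treated together. *)
Lemma path_weight_to_layer1 (y : M) (u : M * 'F_2) (p : seq (M * 'F_2)) :
  path edge u p -> last u p = (y, 1) ->
  if u.2 == 0 then exists w, d0 u.1 w + r w + d1 w y <= path_weight weight u p
  else d1 u.1 y <= path_weight weight u p.
Proof.
elim: p u => [|v p IH] u /=.
  by move=> _ -> /=; rewrite (metric_eq0 hd1 y y).2.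
case/andP=> euv pp lp; have := IH v pp lp => {IH pp lp}.
move: (path_weight _ v p) euv => W.
case: u v => [x i] [z j]; rewrite /edge /weight /twisted_edge /twisted_weight /=.
(* An edge inside a layer is absorbed by the triangle inequality of that layer's metric. *)
have [<-{j} _|ij /= /eqP <-{z}] := eqVneq i j.
  case: ifP => _ => [[w]|].
    by move=> ?; exists w; have := metric_triangle hd0 x z w; lra.
  by have := metric_triangle hd1 x z y; lra.
(* Crossing up from layer 0: the rest of the path costs at least [d1 x y], so the crossing point is
   [x] itself. *)
have [i0|i1] := eqVneq i 0.
  rewrite i0 eq_sym in ij; rewrite (negPf ij) => ?.
  by exists x; rewrite (metric_eq0 hd0 x x).2 //; lra.
(* Crossing down from layer 1: the rest returns at some [w], and this detour costs at least
   [r x + d0 x w + r w], hence at least [d1 x w]. *)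
rewrite (F2_neq0 i1) eq_sym in ij.
have -> /= : j == 0 by apply: contraNT ij => /F2_neq0 ->.
move=> [w]; have := metric_triangle hd1 x w y.
by have [] := hcompat x w; rewrite ler_norml => /andP[]; lra.
Qed.

Lemma twisted_union_dist01_le (w x y : M) :
  d (x, 0) (y, 1) <= d0 x w + r w + d1 w y.
Proof.
(* For [w = x] or [w = y] one of the edges is a loop of weight 0. *)
pose p : seq (M * 'F_2) := [:: (w, 0); (w, 1); (y, 1)].
have -> : d0 x w + r w + d1 w y = path_weight weight (x, 0) p.
  by rewrite /= /weight /twisted_weight /= addr0 addrA.
apply: shortest_path_dist_le => //; first exact: twisted_weight_ge0.
by rewrite /= /twisted_edge /= !eqxx.
Qed.

Lemma le_twisted_union_dist01 (c : R) (x y : M) :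
  (forall w, c <= d0 x w + r w + d1 w y) -> c <= d (x, 0) (y, 1).
Proof.
move=> cP; apply: le_shortest_path_dist.
  by exists [:: (x, 1); (y, 1)] => //; rewrite /= /twisted_edge /= !eqxx.
by move=> p pp /(path_weight_to_layer1 pp)[w]; exact: le_trans.
Qed.

Lemma twisted_union_dist01_le_min (x y : M) :
  d (x, 0) (y, 1) <= min_dist d0 d1 x y + Num.max (r x) (r y).
Proof.
have := twisted_union_dist01_le x x y; have := twisted_union_dist01_le y x y.
rewrite (metric_eq0 hd0 x x).2 // (metric_eq0 hd1 y y).2 //.
rewrite /min_dist; case: (leP (d0 x y) (d1 x y)); case: (leP (r x) (r y)); lra.
Qed.

(** Replacing [d1 w y] by [d0 w y] costs [r w + r y], and replacing [d0 x w] by [d1 x w] costs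
    [r x + r w]. The minimum lies below both resulting bounds. *)
Lemma min_dist_le_crossing (w x y : M) :
  min_dist d0 d1 x y <= d0 x w + r w + d1 w y + Num.min (r x) (r y).
Proof.
have := metric_triangle hd0 x w y; have := metric_triangle hd1 x w y.
have [] := hcompat x w; rewrite ler_norml => /andP[? ?] _.
have [] := hcompat w y; rewrite ler_norml => /andP[? ?] _.
rewrite /min_dist; case: (leP (d0 x y) (d1 x y)); case: (leP (r x) (r y)); lra.
Qed.

End TwistedUnionDistance.

Theorem lemma3p4 (R : realType) (M : finType) (d0 d1 : M -> M -> R) (r : M -> R)
    (hd0 : is_metric d0) (hd1 : is_metric d1)
    (hr : forall x, 0 < r x)
    (hcompat : joining_compatible d0 d1 r)
    (L : R) (hL : 0 < L)
    (hLip : forall x y, `|r x - r y| <= L * Num.min (d0 x y) (d1 x y)) :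
  let d := twisted_union_dist d0 d1 r in
  let h := min_dist d0 d1 in
  let A := Num.max (2 * L + 1) 3 in
  [/\ (forall x y : M,
         A^-1 * (h x y + Num.max (r x) (r y)) <= d (x, 0) (y, 1) /\
         d (x, 0) (y, 1) <= h x y + Num.max (r x) (r y)),
      (forall c : R, 0 < c -> (forall x, r x = c) ->
         forall x y : M,
           3^-1 * (c + h x y) <= d (x, 0) (y, 1) /\
           d (x, 0) (y, 1) <= c + h x y)
    & (is_metric h ->
         forall c : R, 0 < c -> (forall x, r x = c) ->
         forall x y : M, d (x, 0) (y, 1) = c + h x y)].
Proof.
move=> d h A.
have dle := twisted_union_dist01_le_min hd0 hd1 hr.
have hle := min_dist_le_crossing hd0 hd1 hcompat.
have led := le_twisted_union_dist01 hd0 hd1 hcompat.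
have d0_ge0 := metric_ge0 hd0; have d1_ge0 := metric_ge0 hd1.
have max_min x y : Num.max (r x) (r y) + Num.min (r x) (r y) = r x + r y.
  by rewrite addrC addr_min_max.
split=> [x y|c c0 rc x y|hm c c0 rc x y].
- split; last exact: dle.
  have AL : 2 * L + 1 <= A by rewrite le_max lexx.
  have A3 : 3 <= A by rewrite le_max lexx orbT.
  apply: led => w; rewrite ler_pdivrMl; last by lra.
  have rxw : r x - r w <= L * d0 x w.
    apply: le_trans (ler_norm _) (le_trans (hLip x w) _).
    by rewrite ler_pM2l // ge_min lexx.
  have ryw : r y - r w <= L * d1 w y.
    rewrite (metric_sym hd1) (le_trans (ler_norm _)) // (le_trans (hLip y w)) //.
    by rewrite ler_pM2l // ge_min lexx orbT.
  (* Adding the maximum turns [min + max] into [r x + r y], at most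
     [2 * r w + L * (d0 x w + d1 w y)]. The total is at most
     [(L + 1) * (d0 x w + d1 w y) + 3 * r w], and [A] dominates both coefficients. *)
  have := hle w x y; have := max_min x y; rewrite -/h.
  have a0 := d0_ge0 x w; have b0 := d1_ge0 w y; have rw0 := hr w.
  have : (L + 1) * d0 x w <= A * d0 x w by rewrite ler_wpM2r //; lra.
  have : (L + 1) * d1 w y <= A * d1 w y by rewrite ler_wpM2r //; lra.
  have : 3 * r w <= A * r w by rewrite ler_wpM2r // ltW.
  by rewrite !mulrDl !mulrDr !mul1r; lra.
- split; last by have := dle x y; rewrite !rc maxxx addrC.
  (* Here [c + h x y] is at most [d0 x w + d1 w y + 3 * c], whence the factor 3. *)
  apply: led => w; have := hle w x y; rewrite !rc minxx -/h.
  by have := d0_ge0 x w; have := d1_ge0 w y; lra.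
- apply/le_anti/andP; split; first by have := dle x y; rewrite !rc maxxx addrC.
  apply: led => w; rewrite rc; have := metric_triangle hm x w y.
  have : h x w <= d0 x w by rewrite ge_min lexx.
  have : h w y <= d1 w y by rewrite ge_min lexx orbT.
  lra.
Qed.
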